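(* Suppose it is known that $\sigma_1\le\sigma_2\le\cdots\le\sigma_k$. Let $d_1=p^{-1}(1-\exp\{-p/(n_1+n_2+1)\})$, $d_2=p^{-1}(1-\exp\{-p/(n+1)\})$ with $n=\sum_{j=1}^k n_j$, and $c_{0i}=p^{-1}(1-e^{-p/(n_i+1)})$. Then, with respect to the linex loss $L(\sigma_i,\delta)=\exp\{p(\delta/\sigma_i-1)\}-p(\delta/\sigma_i-1)-1$: (i) the unrestricted best scale equivariant estimator $c_{01}S_1$ of $\sigma_1$ is inadmissible and is dominated by the estimator which, with $U_2=S_2/S_1$, equals $d_1S_1$ if $c_{01}<d_1$; $c_{01}S_1$ if $d_1\le c_{01}\le d_1(1+U_2)$; and $d_1(1+U_2)S_1$ if $c_{01}>d_1(1+U_2)$; (ii) for each $i=2,\dots,k$, the unrestricted best scale equivariant estimator $c_{0i}S_i$ of $\sigma_i$ is inadmissible and is dominated by the estimator which, with $U_j=S_j/S_i$ for $j\neq i$, equals $d_2\big(1+\sum_{j=1}^{i-1}U_j\big)S_i$ if $c_{0i}<d_2\big(1+\sum_{j=1}^{i-1}U_j\big)$, and equals $c_{0i}S_i$ otherwise.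
   Context: Let $k\ge2$, let $n_1,\dots,n_k\ge1$ be integers and let $p\ne0$ be a fixed real number. For $i=1,\dots,k$, $(X_{i1},\dots,X_{in_i})$ is a random sample from the exponential distribution with known location $0$ and unknown scale $\sigma_i>0$ (density $\sigma_i^{-1}e^{-x/\sigma_i}$, $x>0$), and the $k$ samples are independent. Put $S_i=\sum_{j=1}^{n_i}X_{ij}$, so that $S_1,\dots,S_k$ are independent with $S_i\sim\mathrm{Gamma}(n_i,\sigma_i)$ (shape $n_i$, scale $\sigma_i$). The unrestricted best scale equivariant estimator of $\sigma_i$ is the minimum-risk estimator among those of the form $cS_i$, $c$ a constant; it is $c_{0i}S_i$. The risk of an estimator $\delta$ of $\sigma_i$ is $E_{\underline\sigma}L(\sigma_i,\delta)$. An estimator $\delta'$ dominates $\delta$ if its risk is at most that of $\delta$ for every $\underline\sigma=(\sigma_1,\dots,\sigma_k)$ with $\sigma_1\le\cdots\le\sigma_k$, with strict inequality for at least one such $\underline\sigma$; $\delta$ is inadmissible if some estimator dominates it. *)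

(* Defs.v *)
From HB Require Import structures.
From mathcomp Require Import all_boot all_order all_algebra.
From mathcomp Require Import all_classical all_reals all_analysis.

Set Implicit Arguments.
Unset Strict Implicit.
Unset Printing Implicit Defensive.
Import Order.TTheory GRing.Theory Num.Theory.
Local Open Scope classical_set_scope.
Local Open Scope ring_scope.

Definition mutually_independent d (T : measurableType d) (R : realType)
    (P : probability T R) (I : finType) (Y : I -> {mfun T >-> R}) : Prop :=
  forall (J : {set I}) (B : I -> set R), (forall i, measurable (B i)) ->
    P (\bigcap_(i in [set` J]) (Y i @^-1` B i)) =
    (\prod_(i in J) P (Y i @^-1` B i))%E.

Definition linex_loss (R : realType) (p s delta : R) : R :=
  expR (p * (delta / s - 1)) - p * (delta / s - 1) - 1.

Section samples.
Context d (T : measurableType d) (R : realType).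
Variables (k : nat) (n : 'I_k -> nat).
Variable P : ('I_k -> R) -> probability T R.
Variable X : forall i : 'I_k, 'I_(n i) -> {mfun T >-> R}.

Definition positive_scales (sigma : 'I_k -> R) : Prop :=
  forall i, 0 < sigma i.

Definition ordered_scales (sigma : 'I_k -> R) : Prop :=
  positive_scales sigma /\
  forall i j : 'I_k, (i <= j)%N -> sigma i <= sigma j.

(* The statistical model: the observations [X i j] do not depend on the
   parameter, only their joint law [P sigma] does.  The library's
   [exponential_prob] is parametrized by the rate, i.e. the inverse scale. *)
Definition exponential_samples : Prop :=
  forall sigma, positive_scales sigma ->
    mutually_independent (P sigma)
      (fun ij : {i : 'I_k & 'I_(n i)} => X (tagged ij)) /\
    forall (i : 'I_k) (j : 'I_(n i)) (B : set R), measurable B ->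
      P sigma (X j @^-1` B) = exponential_prob (sigma i)^-1 B.

Definition sample_sum (i : 'I_k) (w : T) : R := \sum_(j < n i) X j w.

(* Estimators are the statistics that are measurable with respect to the
   sigma-algebra generated by the observations. *)
Definition is_estimator (delta : T -> R) : Prop :=
  forall B : set R, measurable B ->
    <<s [set A | exists (i : 'I_k) (j : 'I_(n i)) (C : set R),
           measurable C /\ A = X j @^-1` C] >> (delta @^-1` B).

Definition risk (p : R) (i : 'I_k) (delta : T -> R) (sigma : 'I_k -> R)
    : \bar R :=
  ('E_(P sigma)[fun w => linex_loss p (sigma i) (delta w)])%E.

(* [c * S_i] is the unique minimum-risk estimator among the multiples of [S_i],
   over the unrestricted parameter space. *)
Definition best_scale_equivariant (p : R) (i : 'I_k) (c : R) : Prop :=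
  forall sigma, positive_scales sigma -> forall c' : R, c' != c ->
    (risk p i (fun w => c * sample_sum i w)%R sigma <
     risk p i (fun w => c' * sample_sum i w)%R sigma)%E.

Definition dominates (p : R) (i : 'I_k) (delta' delta : T -> R) : Prop :=
  [/\ is_estimator delta',
      forall sigma, ordered_scales sigma ->
        (risk p i delta' sigma <= risk p i delta sigma)%E &
      exists2 sigma, ordered_scales sigma &
        (risk p i delta' sigma < risk p i delta sigma)%E].

Definition inadmissible (p : R) (i : 'I_k) (delta : T -> R) : Prop :=
  exists delta', dominates p i delta' delta.

End samples.

(* Main.v *)
Require Import Defs.
From HB Require Import structures.
From mathcomp Require Import all_boot all_order all_algebra.
From mathcomp Require Import all_classical all_reals all_analysis.
From mathcomp Require Import measurable_realfun ring lra.
Set Implicit Arguments.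
Unset Strict Implicit.
Unset Printing Implicit Defensive.
Import Order.TTheory GRing.Theory Num.Theory.
Local Open Scope classical_set_scope.
Local Open Scope ring_scope.

(** Write f for the linex loss as a function of delta / sigma_i; it is convex,
    with derivative f' (x) = p (e^(p (x - 1)) - 1).  Fix scales sigma, a set J
    of populations containing i, and let V be the sum over J of S_j / sigma_j,
    a Gamma variable of shape N, the number of observations in J.  Put
    d = (1 - e^(- p / (N + 1))) / p.

    Everything rests on one identity.  If M >= 0 is a function of the
    observations that is homogeneous of degree 1 under scaling of the
    observations in J, and E [M] is finite, then E [M f' (d V)] = 0.  Indeed,
    dividing those observations by l multiplies their density by
    l^N e^((1 - l) V), so E [M e^((1 - l) V)] = l^-(N + 1) E [M], and
    l = e^(- p / (N + 1)) gives 1 - l = p d and l^-(N + 1) = e^p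
    (integral_shrink, integral_stationary).  Homogeneity plays here the role
    of conditioning on the ratios U_j.

    Let now A = delta / sigma_i and B = delta' / sigma_i be degree-1
    homogeneous, and suppose that B lies between A and d V.  By convexity
      f (A) - f (B) >= f' (B) (A - B) >= f' (d V) (A - B),
    and the last term has mean zero, so the risk of delta' is at most that of
    delta; strict convexity makes it smaller as soon as delta and delta'
    differ with positive probability (linex_risk_le, linex_risk_lt,
    statistic_risk_le, statistic_risk_lt).  With J = {i}, B = d V and
    A = c S_i / sigma_i this says that d S_i is the best multiple of S_i
    (best_factor_optimal).

    The two improved estimators move c_0i S_i towards d V sigma_i without
    crossing it.  For the first one J = {1, 2}: since d decreases with N, it is
    the smaller of c_01 S_1 and d (S_1 + S_2), and d (S_1 + S_2) >= d V sigma_1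
    because sigma_1 <= sigma_2.  For the second one J contains all the
    populations: it is the larger of c_0i S_i and
    d (S_i + sum over j < i of S_j), and the latter is at most d V sigma_i
    because sigma_j <= sigma_i for j < i. *)

(** * Scaling an exponential variable *)

Lemma measurable_invr (R : realType) : measurable_fun [set: R] (@GRing.inv R).
Proof.
rewrite -(setvU [set (0:R)]); apply/measurable_funU => //.
  exact: measurableC.
split; last exact: measurable_fun_set1.
apply: open_continuous_measurable_fun.
  apply: closed_openC; apply: accessible_closed_set1.
  by apply: hausdorff_accessible; exact: Rhausdorff.
move=> x; rewrite inE => /eqP x0; exact: inv_continuous.
Qed.

Section exponential_law.
Context {R : realType}.
Implicit Types (r l x : R).
Local Notation mu := (@lebesgue_measure R).

(** The probability structure of [exponential_prob r] has the positivity of the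
    rate as an argument; this bundles the two. *)
Definition exponential_law r (r0 : 0 < r) : probability (measurableTypeR R) R :=
  exponential_distribution_exponential_prob__canonical__probability_measure_Probability
    r0.

Lemma exponential_prob_lt0 r : exponential_prob r `]-oo, 0[ = 0%E.
Proof.
rewrite /exponential_prob integral0_eq// => x /=.
by rewrite in_itv/= => x0; rewrite lt0_exponential_pdf.
Qed.

Lemma measurable_exponential_pdfE r :
  measurable_fun [set: R] (EFin \o exponential_pdf r).
Proof. by apply/measurable_EFinP; exact: measurable_exponential_pdf. Qed.

Lemma exponential_prob_le0 r : exponential_prob r `]-oo, 0] = 0%E.
Proof.
rewrite -[RHS](exponential_prob_lt0 r) /exponential_prob.
rewrite integral_itv_bndo_bndc//.
by apply: measurable_funTS; exact: measurable_exponential_pdfE.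
Qed.

Lemma exponential_prob_gt r x (r0 : 0 < r) : 0 <= x ->
  exponential_prob r `]x, +oo[ = (expR (- r * x))%:E.
Proof.
move=> x0; pose q := exponential_law r0.
rewrite -setCitvl -[LHS]/(q _) probability_setC//.
suff -> : q `]-oo, x]%classic = (1 - expR (- r * x))%:E.
  by rewrite -EFinB opprB addrC subrK.
have [->|xn0] := eqVneq x 0.
  by rewrite mulr0 expR0 subrr; exact: exponential_prob_le0.
have xgt0 : 0 < x by rewrite lt_neqAle eq_sym xn0.
have -> : `]-oo, x]%classic = `]-oo, 0[ `|` `[0, x] :> set R.
  apply/seteqP; split=> y; rewrite /= !in_itv/=.
    by move=> yx; have [y0|y0] := ltP y 0; [left|right; rewrite yx].
  by case=> [y0|/andP[]//]; exact: le_trans (ltW y0) x0.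
rewrite measureU//; last first.
  apply/seteqP; split=> y//=; rewrite !in_itv/= => -[y0 /andP[]].
  by rewrite leNgt y0.
rewrite [X in (X + _)%E]exponential_prob_lt0 add0e.
by rewrite [LHS]exponential_prob_itv0c.
Qed.

Lemma exponential_prob_gtT r x (r0 : 0 < r) : x < 0 ->
  exponential_prob r `]x, +oo[ = 1%E.
Proof.
move=> x0; pose q := exponential_law r0.
rewrite -setCitvl -[LHS]/(q _) probability_setC//.
suff -> : q `]-oo, x]%classic = 0%E by rewrite sube0.
apply/eqP; rewrite eq_le measure_ge0 andbT -(exponential_prob_lt0 r).
rewrite -[leRHS]/(q _); apply: le_measure; rewrite ?inE//.
by move=> y; rewrite /= !in_itv/= => /le_lt_trans; exact.
Qed.

(** A probability on the line is determined by its tails; both tails at [x] are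
    [e^(- r (x l))] for [x >= 0], and 1 otherwise. *)
Lemma exponential_prob_scale r l B : 0 < r -> 0 < l -> measurable B ->
  exponential_prob r ((fun x => x / l) @^-1` B) = exponential_prob (l * r) B.
Proof.
move=> r0 l0 mB.
have mdiv : measurable_fun [set: measurableTypeR R]
    (fun x => x / l : measurableTypeR R).
  exact: measurable_funM.
have lr0 : 0 < l * r by rewrite mulr_gt0.
pose f : {mfun measurableTypeR R >-> measurableTypeR R} :=
  @mfun_Sub _ _ (measurableTypeR R) (measurableTypeR R) _ (mem_set mdiv).
rewrite -[LHS]/(distribution (exponential_law r0) f B).
rewrite -[RHS]/(exponential_law lr0 B).
apply: (@measure_unique _ R (measurableTypeR R) (@RGenOInfty.G R)
  (fun n => `](- n%:R), +oo[%classic) _ _ _ _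
  (distribution (exponential_law r0) f) (exponential_law lr0)) => //.
- exact: RGenOInfty.measurableE.
- move=> _ _ [x ->] [y ->]; exists (Num.max x y).
  by apply/seteqP; split=> z; rewrite /= !in_itv/= !andbT gt_max => /andP.
- by move=> i; exists (- i%:R).
- apply/seteqP; split=> // x _ /=; exists (Num.truncn `|x|).+1 => //=.
  rewrite in_itv/= andbT ltrNl.
  by rewrite (le_lt_trans _ (truncnS_gt _))// -normrN ler_norm.
- move=> _ [x ->]; rewrite /distribution /pushforward/=.
  have -> : (fun y => y / l) @^-1` `]x, +oo[ = `](x * l), +oo[%classic.
    by apply/seteqP; split=> y; rewrite /= !in_itv/= !andbT ltr_pdivlMr.
  have [x0|x0] := leP 0 x.
    rewrite !exponential_prob_gt ?mulr_ge0 ?(ltW l0)//.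
    by congr (expR _)%:E; ring.
  by rewrite !exponential_prob_gtT// pmulr_llt0.
- move=> k; apply: le_lt_trans (probability_le1 _ _) _ => //.
  exact: ltry.
Qed.

Lemma exponential_law_dom r (r0 : 0 < r) : exponential_law r0 `<< mu.
Proof.
apply/null_content_dominatesP => /= A mA muA0.
rewrite /exponential_prob; apply: null_set_integral => //=.
by apply: measurable_funTS; exact: measurable_exponential_pdfE.
Qed.

(** The density is, almost everywhere, the Radon-Nikodym derivative. *)
Lemma integral_exponential_law r (r0 : 0 < r) (h : R -> \bar R) :
  (forall x, 0 <= h x)%E -> measurable_fun [set: measurableTypeR R] h ->
  (\int[exponential_law r0]_x h x =
   \int[mu]_x (h x * (exponential_pdf r x)%:E))%E.
Proof.
move=> h0 mh; have qmu := exponential_law_dom r0.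
rewrite -(Radon_Nikodym_SigmaFinite.change_of_variables qmu)//.
have int_rn := Radon_Nikodym_SigmaFinite.f_integrable qmu.
have mpdf : measurable_fun [set: measurableTypeR R]
    (fun x => (exponential_pdf r x)%:E).
  exact: measurable_exponential_pdfE.
apply: ae_eq_integral => //.
- by apply: emeasurable_funM => //; exact: measurable_int int_rn.
- by apply: emeasurable_funM.
- apply: ae_eqe_mul2l; apply: integral_ae_eq => // E _ mE.
  by rewrite -Radon_Nikodym_SigmaFinite.f_integral.
Qed.

(** The likelihood ratio at [x] of the rates [l * r] and [r]. *)
Definition tilt l r x := l * expR (- ((l - 1) * (r * x))).

Lemma tilt_ge0 l r x : 0 < l -> 0 <= tilt l r x.
Proof. by move=> l0; rewrite /tilt mulr_ge0 ?expR_ge0// ltW. Qed.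

Lemma measurable_tilt l r : measurable_fun [set: measurableTypeR R] (tilt l r).
Proof.
apply: measurable_funM => //; apply: measurableT_comp => //.
by apply: measurableT_comp => //; apply: measurable_funM.
Qed.

Lemma tilt_pdf l r x :
  exponential_pdf (l * r) x = tilt l r x * exponential_pdf r x.
Proof.
have [x0|x0] := ltP x 0; first by rewrite !lt0_exponential_pdf// mulr0.
rewrite !exponential_pdfE// /tilt mulrACA -expRD.
by congr (_ * expR _); ring.
Qed.

(** [x / l] has rate [l * r], so its law has density [tilt l r] with respect to
    the law of [x]. *)
Lemma integral_exponential_scale r l (r0 : 0 < r) (h : R -> \bar R) :
  0 < l -> (forall x, 0 <= h x)%E ->
  measurable_fun [set: measurableTypeR R] h ->
  (\int[exponential_law r0]_x h (x / l)%R =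
   \int[exponential_law r0]_x (h x * (tilt l r x)%:E))%E.
Proof.
move=> l0 h0 mh.
have mdiv : measurable_fun [set: measurableTypeR R]
    (fun x => x / l : measurableTypeR R).
  exact: measurable_funM.
have lr0 : 0 < l * r by rewrite mulr_gt0.
transitivity (\int[exponential_law lr0]_x h x)%E.
  refine (etrans (esym (@ge0_integral_pushforward _ _ _ (measurableTypeR R) R
    _ mdiv (exponential_law r0) setT h measurableT mh (fun x _ => h0 x))) _).
  by apply: eq_measure_integral => B mB _; exact: exponential_prob_scale.
rewrite !integral_exponential_law//; last 2 first.
- by move=> x; rewrite mule_ge0// lee_fin tilt_ge0.
- apply: emeasurable_funM => //; apply/measurable_EFinP.
  exact: measurable_tilt.
by apply: eq_integral => x _; rewrite tilt_pdf EFinM muleA.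
Qed.

End exponential_law.

(** Otherwise the tails at [0] and at [e] would be equal. *)
Lemma exponential_prob_gt0 {R : realType} (r e : R) : 0 < r -> 0 < e ->
  (0 < exponential_prob r `]0%R, e])%E.
Proof.
move=> r0 e0; pose q := exponential_law r0.
have : q `]0, +oo[%classic = (q `]0%R, e]%classic + q `]e, +oo[%classic)%E.
  rewrite -measureU//.
    congr (q _); apply/seteqP; split=> y; rewrite /= !in_itv/= !andbT.
      by move=> ->; case: (leP y e); [left|right].
    by case=> [/andP[]//|]; exact: lt_trans.
  apply/seteqP; split=> y//=; rewrite !in_itv/= !andbT => -[/andP[_]].
  by rewrite leNgt => /negP.
rewrite [q `]0, +oo[%classic]exponential_prob_gt// mulr0 expR0.
rewrite [q `]e, +oo[%classic]exponential_prob_gt ?ltW// => q1.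
rewrite lt0e [(0 <= _)%E](measure_ge0 q) andbT; apply/eqP => q0.
move: q1; rewrite [q `]0, e]%classic]q0 add0e => -[] re1.
have : expR (- r * e) < 1 by rewrite expR_lt1 mulNr oppr_lt0 mulr_gt0.
by rewrite -re1 ltxx.
Qed.

(** * Joint laws of independent observations *)

Section coordinate_space.
Context {R : realType} (I : finType).

(** Families of reals carry the product sigma-algebra, generated by the
    measurable rectangles, which form a pi-system. *)
Definition coordinate_space : Type := I -> R.

Definition coordinate_display : measure_display.
Proof. exact. Qed.

HB.instance Definition _ := gen_eqMixin coordinate_space.
HB.instance Definition _ := gen_choiceMixin coordinate_space.
HB.instance Definition _ :=
  isPointed.Build coordinate_space (fun=> 0 : R).

Definition rectangle (B : I -> set R) : set coordinate_space :=
  [set y | forall i, B i (y i)].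

Definition rectangles : set (set coordinate_space) :=
  [set A | exists2 B : I -> set R,
     (forall i, measurable (B i)) & A = rectangle B].

HB.instance Definition _ :=
  @isMeasurable.Build coordinate_display coordinate_space <<s rectangles >>
    (@sigma_algebra0 _ setT rectangles) (@sigma_algebraC _ rectangles)
    (@sigma_algebra_bigcup _ setT rectangles).

Lemma measurable_rectangle (B : I -> set R) :
  (forall i, measurable (B i)) -> measurable (rectangle B).
Proof. by move=> mB; apply: sub_sigma_algebra; exists B. Qed.

Lemma rectangles_setT : rectangles setT.
Proof. by exists (fun=> setT) => //; apply/seteqP; split. Qed.

Lemma rectangles_setI : setI_closed rectangles.
Proof.
move=> _ _ [B mB ->] [C mC ->]; exists (fun i => B i `&` C i).
  by move=> i; exact: measurableI.
by apply/seteqP; split=> y; [move=> [By Cy] i; split|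
  move=> BCy; split=> i; have [] := BCy i].
Qed.

Lemma measurable_coordinate (i : I) :
  measurable_fun [set: coordinate_space] (fun y : coordinate_space => y i).
Proof.
move=> _ B mB; rewrite setTI; apply: sub_sigma_algebra.
exists (fun j => if j == i then B else setT); first by move=> j; case: ifP.
apply/seteqP; split=> y.
  by move=> /= By j; case: eqP => [->|].
by move=> /(_ i); rewrite eqxx.
Qed.

Lemma measurable_fun_coordinates d (T : measurableType d)
    (f : T -> coordinate_space) :
  (forall i, measurable_fun [set: T] (fun w => f w i)) ->
  measurable_fun [set: T] f.
Proof.
move=> mf; apply: (measurability rectangles) => // _ [_ [B mB ->] <-].
rewrite setTI (_ : _ @^-1` _ = \bigcap_(i in [set: I]) ((f ^~ i) @^-1` B i)).
  apply: fin_bigcap_measurable => // i _.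
  by rewrite -[X in measurable X]setTI; exact: mf.
by apply/seteqP; split=> w Bw i; [move=> _; exact: Bw|exact: Bw].
Qed.

Definition replace (y : I -> R) (i : I) (x : R) : I -> R :=
  fun j => if j == i then x else y j.

Definition shrink (s : seq I) (l : R) (y : I -> R) : I -> R :=
  fun j => if j \in s then y j / l else y j.

End coordinate_space.

Definition joint {R : realType} (I : finType) d (T : measurableType d)
  (Y : I -> {mfun T >-> R}) (w : T) : @coordinate_space R I := fun i => Y i w.

Section resampling.
Context {R : realType} (I : finType) d (T : measurableType d).
Variables (P : probability T R) (Y : I -> {mfun T >-> R}).
Hypothesis indepY : mutually_independent P Y.
Local Notation E := (@coordinate_space R I).
Local Notation obs := (joint Y).

Lemma measurable_joint : measurable_fun [set: T] obs.
Proof. by apply: measurable_fun_coordinates => i. Qed.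

Lemma independent_rectangle (B : I -> set R) : (forall i, measurable (B i)) ->
  P (obs @^-1` rectangle B) = (\prod_i P (Y i @^-1` B i))%E.
Proof.
move=> mB; have := indepY [set: I]%SET mB.
rewrite (eq_bigl predT) => [<-|i]; last by rewrite inE.
congr (P _); apply/seteqP; split=> w Bw i //=.
by apply: Bw; rewrite /= inE.
Qed.

Section one_coordinate.
Variables (i : I) (q : probability (measurableTypeR R) R).
Hypothesis Yq : forall B : set R, measurable B -> P (Y i @^-1` B) = q B.

Let redraw (z : T * measurableTypeR R) : E := replace (obs z.1) i z.2.

Let measurable_redraw : measurable_fun [set: T * measurableTypeR R] redraw.
Proof.
apply: measurable_fun_coordinates => j; rewrite /redraw /replace.
case: eqP => _; first exact: measurable_snd.
by apply: (measurableT_comp _ measurable_fst).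
Qed.

(** Both sides are the product over [j] of the probabilities of
    [Y j \in B j]. *)
Let redraw_rectangle (B : I -> set R) : (forall j, measurable (B j)) ->
  (P \x q)%E (redraw @^-1` rectangle B) = P (obs @^-1` rectangle B).
Proof.
move=> mB; pose B' j := if j == i then setT else B j.
have mB' j : measurable (B' j) by rewrite /B'; case: ifP.
have -> : redraw @^-1` rectangle B = (obs @^-1` rectangle B') `*` B i.
  apply/seteqP; split=> [[w x] Bwx|[w x] [/= B'w Bx] j] /=; rewrite /redraw/=.
    split=> [j|/=]; last by have := Bwx i; rewrite /redraw /replace eqxx.
    by have := Bwx j; rewrite /redraw /replace /B'; case: eqP.
  rewrite /replace; have := B'w j; rewrite /B'.
  by case: eqP => [->|].
have mobsB' : measurable (obs @^-1` rectangle B').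
  have := measurable_joint measurableT (measurable_rectangle mB').
  by rewrite setTI.
rewrite product_measure1E//; last exact: mB.
rewrite -[X in (X * _)%E]/(P (obs @^-1` rectangle B')).
rewrite !independent_rectangle// [X in (X * _)%E = _](bigD1 i)//=.
rewrite [RHS](bigD1 i)//= /B' eqxx.
rewrite preimage_setT probability_setT mul1e muleC Yq//.
by congr (_ * _)%E; apply: eq_bigr => j /negbTE ->.
Qed.

Let redraw_law (A : set E) : measurable A ->
  pushforward (P \x q)%E redraw A = pushforward P obs A.
Proof.
apply: (@measure_unique _ R E (@rectangles R I) (fun=> setT) _ _ _ _
  (measure_function_pushforward__canonical__measure_function_Measure
    (P \x q)%E measurable_redraw)
  (measure_function_pushforward__canonical__measure_function_Measure
    P measurable_joint)) => //.
- exact: rectangles_setI.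
- by move=> _; exact: rectangles_setT.
- by rewrite bigcup_const.
- by move=> _ [B mB ->]; exact: redraw_rectangle.
- move=> _; rewrite -[ltLHS]/((P \x q)%E setT).
  rewrite (_ : setT = setT `*` setT); last by rewrite setXTT.
  rewrite product_measure1E// -[X in (X * _)%E]/(P setT).
  by rewrite -[X in (_ * X)%E]/(q setT) !probability_setT mule1 ltry.
Qed.

(** An independent coordinate may be replaced by an independent copy of it:
    the integral over the [i]-th coordinate can then be taken alone, with the
    others held fixed. *)
Lemma integral_redraw (H : E -> \bar R) : (forall y, 0 <= H y)%E ->
  measurable_fun [set: E] H ->
  (\int[P]_w H (obs w) = \int[P]_w \int[q]_x H (replace (obs w) i x))%E.
Proof.
move=> H0 mH.
have mHr : measurable_fun [set: T * measurableTypeR R] (H \o redraw).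
  exact: measurableT_comp.
rewrite -[RHS](@fubini_tonelli1 _ _ _ _ _ P q (H \o redraw))//; last first.
  by move=> z; exact: H0.
refine (etrans (esym (@ge0_integral_pushforward _ _ _ _ _ _
  measurable_joint P setT H measurableT mH (fun y _ => H0 y))) _).
refine (etrans _ (@ge0_integral_pushforward _ _ _ _ _ _
  measurable_redraw (P \x q)%E setT H measurableT mH (fun y _ => H0 y))).
apply: eq_measure_integral => [|? A mA _]; first exact: measurable_joint.
by apply: esym; exact: redraw_law.
Qed.

End one_coordinate.

Section scaling.
Variables (r : I -> R) (r0 : forall i, 0 < r i).
Hypothesis Yexp : forall i (B : set R), measurable B ->
  P (Y i @^-1` B) = exponential_prob (r i) B.
Variables (l : R) (l0 : 0 < l).

Lemma measurable_replace i (y : E) :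
  measurable_fun [set: measurableTypeR R] (replace y i : _ -> E).
Proof.
apply: (@measurable_fun_coordinates R I _ (measurableTypeR R)) => j.
by rewrite /replace; case: (j == i).
Qed.

Lemma measurable_shrink s : measurable_fun [set: E] (shrink s l : E -> E).
Proof.
apply: measurable_fun_coordinates => j; rewrite /shrink.
have mj := @measurable_coordinate R I j.
by case: (j \in s) => //; exact: measurable_funM.
Qed.

(** Redraw the coordinate [i] and apply the one-dimensional change of scale
    inside the inner integral. *)
Lemma integral_shrink1 i (H : E -> \bar R) : (forall y, 0 <= H y)%E ->
  measurable_fun [set: E] H ->
  (\int[P]_w H (shrink [:: i] l (obs w)) =
   \int[P]_w (H (obs w) * (tilt l (r i) (Y i w))%:E))%E.
Proof.
move=> H0 mH; pose q := exponential_law (r0 i).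
have Yq (B : set R) : measurable B -> P (Y i @^-1` B) = q B by exact: Yexp.
have mHs : measurable_fun [set: E] (H \o shrink [:: i] l).
  by apply: measurableT_comp => //; exact: measurable_shrink.
have mHt : measurable_fun [set: E]
    (fun y : E => (H y * (tilt l (r i) (y i))%:E)%E).
  apply: emeasurable_funM => //; apply/measurable_EFinP.
  apply: measurableT_comp; first exact: measurable_tilt.
  exact: measurable_coordinate.
transitivity (\int[P]_w \int[q]_x H (replace (obs w) i (x / l)%R))%E.
  rewrite (@integral_redraw i q Yq (H \o shrink [:: i] l) (fun y => H0 _) mHs).
  apply: eq_integral => w _; apply: eq_integral => x _ /=; congr (H _).
  apply/funext => j; rewrite /shrink /replace inE.
  by case: eqP.
rewrite (@integral_redraw i q Yq
  (fun y => (H y * (tilt l (r i) (y i))%:E)%E))//; last first.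
  by move=> y; rewrite mule_ge0// lee_fin tilt_ge0.
apply: eq_integral => w _.
rewrite (@integral_exponential_scale R (r i) l (r0 i)
  (fun x => H (replace (obs w) i x)) l0 (fun x => H0 _)
  (measurableT_comp mH (measurable_replace i (obs w)))).
by apply: eq_integral => x _; rewrite {3}/replace eqxx.
Qed.

(** Dividing the coordinates in [s] by [l] changes the joint law by the product
    of their likelihood ratios; the coordinates are treated one at a time, and
    [uniq] ensures that the weights already collected are not rescaled. *)
Lemma integral_shrink s (H : E -> \bar R) : uniq s -> (forall y, 0 <= H y)%E ->
  measurable_fun [set: E] H ->
  (\int[P]_w H (shrink s l (obs w)) =
   \int[P]_w (H (obs w) * (\prod_(i <- s) tilt l (r i) (Y i w))%:E))%E.
Proof.
elim: s H => [|i s IHs] H /=.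
  move=> _ _ _; apply: eq_integral => w _; rewrite big_nil mule1.
  by congr (H _); apply/funext => j.
move=> /andP[is_ us] H0 mH.
transitivity (\int[P]_w (H \o shrink s l) (shrink [:: i] l (obs w)))%E.
  apply: eq_integral => w _; congr (H _); apply/funext => j.
  rewrite /shrink !inE; case: eqP => [->|_]; last by case: ifP.
  by rewrite (negbTE is_).
rewrite (@integral_shrink1 i (H \o shrink s l) (fun y => H0 _)
  (measurableT_comp mH (measurable_shrink s))).
pose Ht := fun y : E => (H y * (tilt l (r i) (y i))%:E)%E.
transitivity (\int[P]_w (Ht (shrink s l (obs w))))%E.
  apply: eq_integral => w _; rewrite /Ht /=; congr (_ * (tilt _ _ _)%:E)%E.
  by rewrite /shrink (negbTE is_).
have Ht0 y : (0 <= Ht y)%E by rewrite mule_ge0// lee_fin tilt_ge0.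
have mHt : measurable_fun [set: E] Ht.
  apply: emeasurable_funM => //; apply/measurable_EFinP.
  apply: measurableT_comp; first exact: measurable_tilt.
  exact: measurable_coordinate.
rewrite (IHs Ht us Ht0 mHt).
by apply: eq_integral => w _; rewrite /Ht big_cons -muleA -EFinM.
Qed.

End scaling.
End resampling.

(** * Convexity of the linex loss *)

Section linex_function.
Context {R : realType}.
Implicit Types p a b v x : R.

Definition linex p x : R := expR (p * (x - 1)) - p * (x - 1) - 1.

Lemma linex_ge0 p x : 0 <= linex p x.
Proof. by rewrite /linex subr_ge0 lerBrDr expR_ge1Dx. Qed.

(** The graph of [linex p] lies above its tangent at [b], because
    [1 + t <= e^t] at [t = p (a - b)]. *)
Lemma linex_tangent p a b :
  p * (a - b) * (expR (p * (b - 1)) - 1) <= linex p a - linex p b.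
Proof.
rewrite /linex.
have -> : p * (a - 1) = p * (b - 1) + p * (a - b) by ring.
rewrite expRD; have := expR_ge1Dx (p * (a - b)).
have := expR_gt0 (p * (b - 1)).
move: (expR (p * (b - 1))) (expR _) (p * (a - b)) => e f t; nra.
Qed.

Lemma linex_tangent_lt p a b : p != 0 -> a != b ->
  p * (a - b) * (expR (p * (b - 1)) - 1) < linex p a - linex p b.
Proof.
move=> p0 ab; rewrite /linex.
have -> : p * (a - 1) = p * (b - 1) + p * (a - b) by ring.
have : 1 + p * (a - b) < expR (p * (a - b)).
  by apply: expR_gt1Dx; rewrite mulf_neq0// subr_eq0.
rewrite expRD; have := expR_gt0 (p * (b - 1)).
move: (expR (p * (b - 1))) (expR _) (p * (a - b)) => e f t; nra.
Qed.

(** The derivative of [linex p] is increasing, and [v] is on the other side of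
    [b] from [a] (or [b] is one of them), so replacing the slope at [b] by the
    slope at [v] can only lower the linear term. *)
Lemma linex_slope_le p a b v : 0 <= (a - b) * (b - v) ->
  p * (a - b) * (expR (p * (v - 1)) - 1) <=
  p * (a - b) * (expR (p * (b - 1)) - 1).
Proof.
move=> abv; rewrite -subr_ge0 -mulrBr.
have pabv : 0 <= (p * (a - b)) * (p * (b - 1) - p * (v - 1)).
  rewrite (_ : _ * _ = p ^+ 2 * ((a - b) * (b - v))); last by ring.
  by rewrite mulr_ge0// sqr_ge0.
move: pabv; move: (p * (a - b)) (p * (b - 1)) (p * (v - 1)) => t x y.
have [t0 txy|t0 txy|-> _] := ltgtP t 0; last by rewrite mul0r.
  have : x <= y by rewrite -subr_le0 -(nmulr_rge0 _ t0).
  by rewrite -ler_expR => xy; rewrite nmulr_rge0//; lra.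
have : y <= x by rewrite -subr_ge0 -(pmulr_rge0 _ t0).
by rewrite -ler_expR => xy; rewrite pmulr_rge0//; lra.
Qed.

(** The positive and negative parts of [p (a - b)].  Separating them keeps all
    the integrands nonnegative, so that the integrals of the inequality below
    split into sums even when they are infinite. *)
Definition excess p a b : R := Num.max 0 (p * (a - b)).
Definition deficit p a b : R := Num.max 0 (- (p * (a - b))).

Lemma excess_deficit p a b : p * (a - b) = excess p a b - deficit p a b.
Proof.
rewrite /excess /deficit; move: (p * (a - b)) => t.
by case: (ltP 0 t) => t0; case: (ltP 0 (- t)) => t1; lra.
Qed.

(** The convexity estimate [linex p a - linex p b >= (a - b) linex' p v], with
    the negative terms moved to the other side. *)
Lemma linex_le p a b v : 0 <= (a - b) * (b - v) ->
  linex p b + excess p a b * expR (p * (v - 1)) + deficit p a b <=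
  linex p a + excess p a b + deficit p a b * expR (p * (v - 1)).
Proof.
move=> /(linex_slope_le p) /le_trans /(_ (linex_tangent p a b)).
rewrite excess_deficit; lra.
Qed.

Lemma linex_lt p a b v : p != 0 -> a != b -> 0 <= (a - b) * (b - v) ->
  linex p b + excess p a b * expR (p * (v - 1)) + deficit p a b <
  linex p a + excess p a b + deficit p a b * expR (p * (v - 1)).
Proof.
move=> p0 ab /(linex_slope_le p) /le_lt_trans /(_ (linex_tangent_lt p0 ab)).
rewrite excess_deficit; lra.
Qed.

End linex_function.

(** * Comparison of risks *)

Section strict_integral.
Context {R : realType} d (T : measurableType d) (P : {measure set T -> \bar R}).
Implicit Types u v : T -> R.

Lemma integralZl_nneg (c : R) (f : T -> R) :
  0 <= c -> measurable_fun [set: T] f -> (forall w, 0 <= f w) ->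
  (\int[P]_w (c * f w)%:E = c%:E * \int[P]_w (f w)%:E)%E.
Proof.
move=> c0 mf f0; under eq_integral do rewrite EFinM.
rewrite ge0_integralZl_EFin//; first by move=> w _; rewrite lee_fin.
exact/measurable_EFinP.
Qed.

Lemma integralD_nneg u v : measurable_fun [set: T] u ->
  measurable_fun [set: T] v -> (forall w, 0 <= u w) -> (forall w, 0 <= v w) ->
  (\int[P]_w (u w + v w)%:E = \int[P]_w (u w)%:E + \int[P]_w (v w)%:E)%E.
Proof.
move=> mu mv u0 v0; rewrite -ge0_integralD//.
- by move=> w _; rewrite lee_fin.
- exact/measurable_EFinP.
- by move=> w _; rewrite lee_fin.
- exact/measurable_EFinP.
Qed.

(** The integral of [v] is that of [u] plus that of the positive part of
    [v - u], even if it is infinite; the second one is positive and the first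
    one is finite. *)
Lemma lt_integral u v :
  measurable_fun [set: T] u -> measurable_fun [set: T] v ->
  (forall w, 0 <= u w) -> (forall w, 0 <= v w) ->
  {ae P, forall w, u w <= v w} ->
  (\int[P]_w (u w)%:E < +oo)%E -> (0 < P [set w | (u w < v w)%R])%E ->
  (\int[P]_w (u w)%:E < \int[P]_w (v w)%:E)%E.
Proof.
move=> mu mv u0 v0 uv ufin Puv.
pose g w := Num.max 0 (v w - u w).
have mg : measurable_fun [set: T] g.
  by apply: measurable_maxr => //; exact: measurable_funB.
have g0 w : 0 <= g w by rewrite /g le_max lexx.
have -> : (\int[P]_w (v w)%:E = \int[P]_w (u w)%:E + \int[P]_w (g w)%:E)%E.
  rewrite -integralD_nneg//.
  apply: ge0_ae_eq_integral => //.
  - exact/measurable_EFinP.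
  - by apply/measurable_EFinP; exact: measurable_funD.
  - by move=> w _; rewrite lee_fin.
  - by move=> w _; rewrite lee_fin addr_ge0.
  - apply: filterS uv => w uvw _.
    by rewrite /g max_r ?subr_ge0// addrC subrK.
rewrite lteDl//; last first.
  by rewrite ge0_fin_numE// integral_ge0// => w _; rewrite lee_fin.
rewrite lt0e integral_ge0 ?andbT; last by move=> w _; rewrite lee_fin.
apply/negP => /eqP g_eq0.
have mEg : measurable_fun [set: T] (fun w => (g w)%:E).
  exact/measurable_EFinP.
have : (\int[P]_w `|(g w)%:E| = 0)%E.
  by rewrite -[RHS]g_eq0; apply: eq_integral => w _; rewrite gee0_abs// lee_fin.
move=> /(ae_eq_integral_abs P measurableT mEg)[N [mN N0 subN]].
move: Puv; rewrite ltNge => /negP; apply; rewrite -N0 le_measure ?inE//.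
  have := measurable_fun_ltr mu mv measurableT (Y := [set true]) I.
  by rewrite setTI; congr measurable; apply/seteqP; split.
move=> w /= uvw; apply: subN => /= /(_ I) [].
by rewrite /g max_r ?subr_ge0 ?(ltW uvw)// => /eqP; rewrite subr_eq0 gt_eqF.
Qed.

End strict_integral.

(** [B] lies between [A] and [V], and the two parts of [p (A - B)] have the same
    integral with and without the weight [e^(p (V - 1))]; hence the terms added
    to both risks in [linex_le] have equal finite integrals and cancel. *)
Section risk_comparison.
Context {R : realType} d (T : measurableType d) (P : {measure set T -> \bar R}).
Variables (p : R) (A B V : T -> R).
Hypotheses (mA : measurable_fun [set: T] A) (mB : measurable_fun [set: T] B)
  (mV : measurable_fun [set: T] V).
Hypothesis ABV : {ae P, forall w, 0 <= (A w - B w) * (B w - V w)}.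

Let e w := expR (p * (V w - 1)).
Let g w := excess p (A w) (B w).
Let l w := deficit p (A w) (B w).

Hypothesis excess_fin : (\int[P]_w (g w)%:E < +oo)%E.
Hypothesis deficit_fin : (\int[P]_w (l w)%:E < +oo)%E.
Hypothesis excess_stationary :
  (\int[P]_w (g w * e w)%:E = \int[P]_w (g w)%:E)%E.
Hypothesis deficit_stationary :
  (\int[P]_w (l w * e w)%:E = \int[P]_w (l w)%:E)%E.

Lemma measurable_linex (f : T -> R) : measurable_fun [set: T] f ->
  measurable_fun [set: T] (fun w => linex p (f w)).
Proof.
move=> mf; have mpf : measurable_fun [set: T] (fun w => p * (f w - 1)).
  by apply: measurable_funM => //; exact: measurable_funB.
apply: measurable_funB => //; apply: measurable_funB => //.
exact: measurableT_comp.
Qed.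

Let me : measurable_fun [set: T] e.
Proof.
apply: measurableT_comp => //; apply: measurable_funM => //.
exact: measurable_funB.
Qed.

Let mpAB : measurable_fun [set: T] (fun w => p * (A w - B w)).
Proof. by apply: measurable_funM => //; exact: measurable_funB. Qed.

Let mg : measurable_fun [set: T] g.
Proof. exact: measurable_maxr. Qed.

Let ml : measurable_fun [set: T] l.
Proof. by apply: measurable_maxr => //; exact: measurableT_comp. Qed.

Let g0 w : 0 <= g w. Proof. by rewrite /g /excess le_max lexx. Qed.
Let l0 w : 0 <= l w. Proof. by rewrite /l /deficit le_max lexx. Qed.

Let u w := linex p (B w) + g w * e w + l w.
Let v w := linex p (A w) + g w + l w * e w.
Let shift := (\int[P]_w (g w)%:E + \int[P]_w (l w)%:E)%E.

Let integral_u : (\int[P]_w (u w)%:E = \int[P]_w (linex p (B w))%:E + shift)%E.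
Proof.
rewrite integralD_nneg//; last 2 first.
- apply: measurable_funD; [exact: measurable_linex|exact: measurable_funM].
- by move=> w; rewrite addr_ge0 ?linex_ge0// mulr_ge0// /e expR_ge0.
rewrite integralD_nneg ?excess_stationary ?addeA//.
- exact: measurable_linex.
- exact: measurable_funM.
- by move=> w; rewrite linex_ge0.
- by move=> w; rewrite mulr_ge0// /e expR_ge0.
Qed.

Let integral_v : (\int[P]_w (v w)%:E = \int[P]_w (linex p (A w))%:E + shift)%E.
Proof.
rewrite integralD_nneg ?deficit_stationary; last 4 first.
- by apply: measurable_funD => //; exact: measurable_linex.
- exact: measurable_funM.
- by move=> w; rewrite addr_ge0 ?linex_ge0.
- by move=> w; rewrite mulr_ge0// /e expR_ge0.
rewrite integralD_nneg ?addeA//.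
- exact: measurable_linex.
- by move=> w; rewrite linex_ge0.
Qed.

Let shift_fin : shift \is a fin_num.
Proof.
rewrite fin_numD; apply/andP; split; rewrite ge0_fin_numE//.
- by apply: integral_ge0 => w _; rewrite lee_fin.
- by apply: integral_ge0 => w _; rewrite lee_fin.
Qed.

Let mu : measurable_fun [set: T] u.
Proof.
apply: measurable_funD => //; apply: measurable_funD.
  exact: measurable_linex.
exact: measurable_funM.
Qed.

Let mv : measurable_fun [set: T] v.
Proof.
apply: measurable_funD; last exact: measurable_funM.
by apply: measurable_funD => //; exact: measurable_linex.
Qed.

Let u0 w : 0 <= u w.
Proof.
rewrite /u /v; apply: addr_ge0; [apply: addr_ge0|];
  by rewrite ?mulr_ge0 ?linex_ge0 ?g0 ?l0 /e ?expR_ge0.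
Qed.

Let v0 w : 0 <= v w.
Proof.
rewrite /u /v; apply: addr_ge0; [apply: addr_ge0|];
  by rewrite ?mulr_ge0 ?linex_ge0 ?g0 ?l0 /e ?expR_ge0.
Qed.

Let uv : {ae P, forall w, u w <= v w}.
Proof. by apply: filterS ABV => w; exact: linex_le. Qed.

Lemma linex_risk_le :
  (\int[P]_w (linex p (B w))%:E <= \int[P]_w (linex p (A w))%:E)%E.
Proof.
rewrite -(leeD2rE _ _ shift_fin) -integral_u -integral_v.
apply: ae_ge0_le_integral => //.
- by move=> w _; rewrite lee_fin.
- exact/measurable_EFinP.
- by move=> w _; rewrite lee_fin.
- exact/measurable_EFinP.
- by apply: filterS uv => w uvw _; rewrite lee_fin.
Qed.

Lemma linex_risk_lt (C : set T) : p != 0 ->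
  (\int[P]_w (linex p (B w))%:E < +oo)%E ->
  measurable C -> (0 < P C)%E ->
  (forall w, C w -> A w != B w /\ 0 <= (A w - B w) * (B w - V w)) ->
  (\int[P]_w (linex p (B w))%:E < \int[P]_w (linex p (A w))%:E)%E.
Proof.
move=> p0 Bfin mC PC CAB.
rewrite -(lteD2rE _ _ shift_fin) -integral_u -integral_v.
apply: lt_integral => //.
  by rewrite integral_u lte_add_pinfty// ltey_eq shift_fin.
apply: lt_le_trans PC _; apply: le_measure; rewrite ?inE//.
  have := measurable_fun_ltr mu mv measurableT (Y := [set true]) I.
  by rewrite setTI; congr measurable; apply/seteqP; split.
by move=> w /CAB[AB ABVw] /=; exact: linex_lt.
Qed.

End risk_comparison.

Definition weighted_sum {R : realType} (I : finType) (r : I -> R) (s : seq I)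
  (y : @coordinate_space R I) : R := \sum_(i <- s) r i * y i.

Definition best_factor {R : realType} (p : R) (N : nat) : R :=
  p^-1 * (1 - expR (- p / (N + 1)%:R)).

(** * The stationarity identity *)

Section stationarity.
Context {R : realType} (I : finType) d (T : measurableType d).
Variables (P : probability T R) (Y : I -> {mfun T >-> R}) (r : I -> R).
Hypothesis indepY : mutually_independent P Y.
Hypothesis r0 : forall i, 0 < r i.
Hypothesis Yexp : forall i (B : set R), measurable B ->
  P (Y i @^-1` B) = exponential_prob (r i) B.
Variables (s : seq I) (us : uniq s).
Local Notation E := (@coordinate_space R I).

Local Notation obs := (joint Y).
Local Notation total := (weighted_sum r s).

Lemma prod_tilt (l : R) (y : E) :
  \prod_(i <- s) tilt l (r i) (y i) = l ^+ size s * expR ((1 - l) * total y).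
Proof.
rewrite /weighted_sum; elim: s => [|i s' IH].
  by rewrite !big_nil mulr0 expR0 mulr1.
rewrite !big_cons IH /= exprS /tilt mulrACA -expRD.
by congr (_ * expR _); ring.
Qed.

Lemma measurable_total : measurable_fun [set: E] total.
Proof.
apply: measurable_sum => i; apply: measurable_funM => //.
exact: measurable_coordinate.
Qed.

Let measurable_total_obs : measurable_fun [set: T] (total \o obs).
Proof.
by apply: measurableT_comp; [exact: measurable_total|exact: measurable_joint].
Qed.

Let measurable_expR_total (c : R) :
  measurable_fun [set: T] (fun w => expR (c * total (obs w))).
Proof. by apply: measurableT_comp => //; exact: measurable_funM. Qed.

Lemma integral_total_laplace (l : R) : 0 < l ->
  (\int[P]_w (expR ((1 - l) * total (obs w)))%:E = ((l ^+ size s)^-1)%:E)%E.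
Proof.
move=> l0; have l0' : 0 < l ^+ size s by rewrite exprn_gt0.
have int1 : (\int[P]_w (cst 1 w) = 1)%E.
  by rewrite integral_cst// mul1e; exact: probability_setT.
have := integral_shrink indepY r0 Yexp l0 us (H := cst 1%E) (fun=> lee01)
  (measurable_cst _).
rewrite [X in X = _ -> _]int1.
under eq_integral do rewrite prod_tilt mul1e.
rewrite (integralZl_nneg _ (ltW l0') (measurable_expR_total _))=> [h|w];
  last exact: expR_ge0.
have := congr1 (mule ((l ^+ size s)^-1)%:E) h.
by rewrite mule1 muleA -EFinM mulVf ?mul1e ?lt0r_neq0.
Qed.

(** Dividing the observations in [s] by [l] divides [M] by [l], and by
    [integral_shrink] it amounts to the weight [l^N e^((1 - l) total)]. *)
Lemma integral_homogeneous (l : R) (M : E -> R) : 0 < l ->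
  (forall y, 0 <= M y) -> measurable_fun [set: E] M ->
  (forall y, M (shrink s l y) = M y / l) ->
  (\int[P]_w (M (obs w) * expR ((1 - l) * total (obs w)))%:E =
   ((l ^+ (size s).+1)^-1)%:E * \int[P]_w (M (obs w))%:E)%E.
Proof.
move=> l0 M0 mM Ml; have l0' : 0 < l ^+ size s by rewrite exprn_gt0.
have mMo : measurable_fun [set: T] (M \o obs).
  by apply: measurableT_comp => //; exact: measurable_joint.
have mEM : measurable_fun [set: E] (EFin \o M) by exact/measurable_EFinP.
have M0' y : (0 <= (EFin \o M) y)%E by rewrite lee_fin.
have := integral_shrink indepY r0 Yexp l0 us M0' mEM.
under eq_integral do rewrite /= Ml mulrC.
under [X in _ = X -> _]eq_integral do rewrite prod_tilt /= -EFinM mulrCA.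
rewrite (integralZl_nneg _ _ mMo) ?invr_ge0 ?ltW//; last by move=> w; exact: M0.
rewrite (integralZl_nneg _ (ltW l0')) => [h||w]; last 2 first.
- exact: measurable_funM.
- by rewrite mulr_ge0// expR_ge0.
have := congr1 (mule ((l ^+ size s)^-1)%:E) h.
by rewrite !muleA -!EFinM mulVf ?mul1e ?lt0r_neq0// exprSr invfM.
Qed.

Variables (p : R) (p0 : p != 0).
Local Notation b := (best_factor p (size s)).

Lemma best_factorK N : p * best_factor p N = 1 - expR (- p / (N + 1)%:R).
Proof. by rewrite /best_factor mulrA divff// mul1r. Qed.

(** The constant [b] makes the expectation of [M] times the derivative of the
    loss at [b * total] vanish, whatever the homogeneous [M]. *)
Lemma integral_stationary (M : E -> R) :
  (forall y, 0 <= M y) -> measurable_fun [set: E] M ->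
  (forall (l : R) y, 0 < l -> M (shrink s l y) = M y / l) ->
  (\int[P]_w (M (obs w) * expR (p * (b * total (obs w) - 1)))%:E =
   \int[P]_w (M (obs w))%:E)%E.
Proof.
(* This [l] satisfies both 1 - l = p b and l^(N + 1) = e^(- p). *)
move=> M0 mM Ml; set l := expR (- p / (size s + 1)%:R).
have l0 : 0 < l := expR_gt0 _.
have mMo : measurable_fun [set: T] (M \o obs).
  by apply: measurableT_comp => //; exact: measurable_joint.
have lN : l ^+ (size s).+1 = expR (- p).
  by rewrite -expRM_natl /l addn1 mulrC divfK// pnatr_eq0.
transitivity (\int[P]_w (expR (- p) *
    (M (obs w) * expR ((1 - l) * total (obs w))))%:E)%E.
  apply: eq_integral => w _; rewrite mulrCA -expRD.
  congr (_ * expR _)%:E; rewrite mulrBr mulr1 mulrA best_factorK -/l; ring.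
rewrite (integralZl_nneg _ (expR_ge0 _)) => [||w]; last 2 first.
- exact: measurable_funM.
- by rewrite mulr_ge0// expR_ge0.
rewrite integral_homogeneous//; last by move=> y; exact: Ml.
by rewrite lN muleA -EFinM divff ?mul1e// gt_eqF// expR_gt0.
Qed.

Lemma integral_total_exp_fin :
  (\int[P]_w (expR (p * (b * total (obs w) - 1)))%:E < +oo)%E.
Proof.
set l := expR (- p / (size s + 1)%:R).
have l0 : 0 < l := expR_gt0 _.
have -> : (\int[P]_w (expR (p * (b * total (obs w) - 1)))%:E =
  \int[P]_w (expR (- p) * expR ((1 - l) * total (obs w)))%:E)%E.
  apply: eq_integral => w _; rewrite -expRD.
  congr (expR _)%:E; rewrite mulrBr mulr1 mulrA best_factorK -/l; ring.
rewrite (integralZl_nneg _ (expR_ge0 _)) => [||w]; last 2 first.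
- exact: measurable_expR_total.
- exact: expR_ge0.
by rewrite integral_total_laplace// -EFinM ltry.
Qed.

Lemma coordinates_gt0 : {ae P, forall w, forall i, 0 < Y i w}.
Proof.
apply: filter_forall => i.
exists (Y i @^-1` `]-oo, 0]%classic); split.
- by rewrite -[X in measurable X]setTI; apply: measurable_funP.
- by rewrite Yexp// exponential_prob_le0.
- by move=> w /= /negP; rewrite -leNgt in_itv.
Qed.

Lemma total_ge0 : {ae P, forall w, 0 <= total (obs w)}.
Proof.
apply: filterS coordinates_gt0 => w Yw; apply: sumr_ge0 => i _.
by apply: mulr_ge0; apply: ltW => //; exact: Yw.
Qed.

(** At [l = 1 / 2] the Laplace transform is finite, and [x <= 2 e^(x / 2)]. *)
Lemma integral_total_fin : (\int[P]_w `|total (obs w)|%:E < +oo)%E.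
Proof.
have mt : measurable_fun [set: T] (fun w => total (obs w)).
  apply: measurableT_comp; first exact: measurable_total.
  exact: measurable_joint.
have mexp := measurable_expR_total (1 - 2^-1).
apply: (@le_lt_trans _ _
    (\int[P]_w (2 * expR ((1 - 2^-1) * total (obs w)))%:E)%E).
  apply: ae_ge0_le_integral => //.
  - by apply/measurable_EFinP; apply: measurableT_comp.
  - by apply/measurable_EFinP; exact: measurable_funM.
  apply: filterS total_ge0 => w tw _; rewrite lee_fin ger0_norm//.
  have := expR_ge1Dx ((1 - 2^-1) * total (obs w)); lra.
rewrite (integralZl_nneg _ _ mexp)//.
by rewrite integral_total_laplace// -EFinM ltry.
Qed.

Lemma linex_total_fin :
  (\int[P]_w (linex p (b * total (obs w)))%:E < +oo)%E.
Proof.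
have mt : measurable_fun [set: T] (fun w => total (obs w)).
  apply: measurableT_comp; first exact: measurable_total.
  exact: measurable_joint.
have mnt : measurable_fun [set: T] (fun w => `|total (obs w)|).
  exact: measurableT_comp.
have mbt : measurable_fun [set: T] (fun w => b * total (obs w)).
  exact: measurable_funM.
have mexp : measurable_fun [set: T]
    (fun w => expR (p * (b * total (obs w) - 1))).
  apply: measurableT_comp => //; apply: measurable_funM => //.
  exact: measurable_funB.
apply: (@le_lt_trans _ _ (\int[P]_w (expR (p * (b * total (obs w) - 1)) +
    (`|p * b| * `|total (obs w)| + `|p|))%:E)%E).
  apply: ae_ge0_le_integral => //.
  - by move=> w _; rewrite lee_fin linex_ge0.
  - by apply/measurable_EFinP; exact: measurable_linex.
  - apply/measurable_EFinP; apply: measurable_funD => //.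
    by apply: measurable_funD => //; exact: measurable_funM.
  apply: aeW => w _; rewrite lee_fin /linex -normrM.
  have := ler_norm (- (p * b * total (obs w))); have := ler_norm p.
  rewrite normrN; lra.
have mbnt : measurable_fun [set: T] (fun w => `|p * b| * `|total (obs w)|).
  exact: measurable_funM.
have mbntc : measurable_fun [set: T]
    (fun w => `|p * b| * `|total (obs w)| + `|p|).
  exact: measurable_funD.
rewrite (integralD_nneg _ mexp mbntc)//.
rewrite (integralD_nneg _ mbnt (measurable_cst _) _ (fun=> normr_ge0 p))//.
rewrite (integralZl_nneg _ (normr_ge0 _) mnt)//.
rewrite lte_add_pinfty ?integral_total_exp_fin// lte_add_pinfty//.
  by rewrite lte_mul_pinfty ?lee_fin//; exact: integral_total_fin.
have -> : (\int[P]_w `|p|%:E = `|p|%:E * P setT)%E by exact: integral_cst.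
by rewrite probability_setT mule1 ltry.
Qed.

End stationarity.

(** * Statistics of the sample sums *)

Definition observation_index (k : nat) (n : 'I_k -> nat) : finType :=
  {i : 'I_k & 'I_(n i)}.

Section model.
Context (R : realType) (disp : measure_display) (T : measurableType disp).
Context (k : nat) (n : 'I_k -> nat).
Variables (P : ('I_k -> R) -> probability T R).
Variable X : forall i : 'I_k, 'I_(n i) -> {mfun T >-> R}.
Hypothesis hX : exponential_samples P X.
Hypothesis hn : forall i, (0 < n i)%N.
Variables (p : R) (p0 : p != 0).
Implicit Types (sigma s : 'I_k -> R) (J : {set 'I_k}).

Local Notation index := (observation_index n).
Local Notation E := (@coordinate_space R index).

Definition observation (ij : index) : {mfun T >-> R} := X (tagged ij).
Local Notation obs := (joint observation).

(** The sample sums as functions of the family of observations, so that the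
    observations can be rescaled underneath a statistic. *)
Definition sums (y : E) (i : 'I_k) : R :=
  \sum_(j < n i) y (Tagged (fun i => 'I_(n i)) j).

Definition block J : seq index := enum [pred ij : index | tag ij \in J].

Definition scaled_total J sigma s : R := \sum_(i in J) s i / sigma i.

Definition shrink_sums J (l : R) s i : R := if i \in J then s i / l else s i.

Lemma size_block J : size (block J) = (\sum_(i in J) n i)%N.
Proof.
rewrite -cardE -sum1_card.
rewrite (eq_bigr (fun i => \sum_(j < n i) 1)%N); last first.
  by move=> i _; rewrite sum1_card card_ord.
rewrite (sig_big_dep (fun i => i \in J) (fun i => xpredT) (fun _ _ => 1%N)).
by apply: eq_bigl => ij; rewrite inE andbT.
Qed.

Lemma block_total J sigma (y : E) :
  weighted_sum (fun ij : index => (sigma (tag ij))^-1) (block J) y =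
  scaled_total J sigma (sums y).
Proof.
rewrite /weighted_sum big_enum /scaled_total.
rewrite (eq_bigr (fun i => \sum_(j < n i)
    (sigma i)^-1 * y (Tagged (fun i => 'I_(n i)) j))); last first.
  by move=> i _; rewrite mulrC mulr_sumr.
rewrite (sig_big_dep (fun i => i \in J) (fun i => xpredT)
  (fun i j => (sigma i)^-1 * y (Tagged (fun i => 'I_(n i)) j))).
by apply: eq_big => [ij|[i j]]; rewrite ?inE ?andbT.
Qed.

Lemma sums_shrink J l y :
  sums (shrink (block J) l y) = shrink_sums J l (sums y).
Proof.
apply/funext => i; rewrite /shrink_sums /sums /shrink.
under eq_bigr do rewrite mem_enum inE /=.
by case: (i \in J) => //; rewrite mulr_suml.
Qed.

Lemma measurable_sums i : measurable_fun [set: E] (fun y : E => sums y i).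
Proof. by apply: measurable_sum => j; exact: measurable_coordinate. Qed.

(** The sets of families whose preimage belongs to the sigma-algebra of the
    observations form a sigma-algebra, which contains the rectangles. *)
Lemma is_estimator_statistic (D : ('I_k -> R) -> R) :
  measurable_fun [set: E] (fun y : E => D (sums y)) ->
  is_estimator X (fun w => D (sums (obs w))).
Proof.
move=> mD B mB.
set G := (X in <<s X >>).
have := mD measurableT B mB; rewrite setTI.
suff sub : <<s @rectangles R index >> `<=` [set A | <<s G >> (obs @^-1` A)].
  by move=> /sub.
apply: smallest_sub.
  split => /=.
  - by rewrite preimage_set0; exact: sigma_algebra0.
  - by move=> A GA; rewrite setTD preimage_setC; exact: sigma_algebraC.
  - by move=> F GF; rewrite preimage_bigcup; exact: sigma_algebra_bigcup.
move=> _ [C mC ->] /=.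
rewrite (_ : _ @^-1` _ =
    \bigcap_(ij in [set: index]) (observation ij @^-1` C ij)); last first.
  by apply/seteqP; split=> w Cw ij; [move=> _; exact: Cw|exact: Cw].
apply: (@fin_bigcap_measurable _ (g_sigma_algebraType G)) => // ij _.
apply: sub_sigma_algebra; exists (tag ij), (tagged ij), (C ij); split => //.
Qed.

Section fixed_scales.
Variables (sigma : 'I_k -> R) (sigma0 : positive_scales sigma).
Let r (ij : index) : R := (sigma (tag ij))^-1.
Let r0 ij : 0 < r ij. Proof. by rewrite invr_gt0; exact: sigma0. Qed.
Let indep : mutually_independent (P sigma) observation.
Proof. by have [] := hX sigma0. Qed.
Let law ij (B : set R) : measurable B ->
  P sigma (observation ij @^-1` B) = exponential_prob (r ij) B.
Proof. exact: (proj2 (hX sigma0) (tag ij) (tagged ij) B). Qed.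

Lemma observations_gt0 : {ae P sigma, forall w, forall ij, 0 < obs w ij}.
Proof. exact: (coordinates_gt0 law). Qed.

Lemma sums_gt0 y : (forall ij, 0 < y ij) -> forall i, 0 < sums y i.
Proof.
move=> y0 i; rewrite /sums (bigD1 (Ordinal (hn i)))//=.
by rewrite ltr_wpDr// sumr_ge0// => j _; exact: ltW.
Qed.

Lemma linex_scaled_total_fin J :
  (\int[P sigma]_w (linex p (best_factor p (\sum_(j in J) n j)%N
     * scaled_total J sigma (sums (obs w))))%:E < +oo)%E.
Proof.
have := linex_total_fin indep r0 law (enum_uniq _ : uniq (block J)) p0.
under eq_integral do rewrite block_total size_block.
by [].
Qed.

(** Two statistics of the sums, both homogeneous of degree 1 in the sums of the
    block [J]: if [D'] lies between [D] and [b * sigma i] times the scaled total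
    of the block, it has the smaller risk. *)
Section comparison.
Variables (J : {set 'I_k}) (i : 'I_k) (D D' : ('I_k -> R) -> R) (C : R).
Hypothesis mD : measurable_fun [set: E] (fun y : E => D (sums y)).
Hypothesis mD' : measurable_fun [set: E] (fun y : E => D' (sums y)).
Hypothesis hD : forall (l : R) s, 0 < l -> D (shrink_sums J l s) = D s / l.
Hypothesis hD' : forall (l : R) s, 0 < l -> D' (shrink_sums J l s) = D' s / l.
Local Notation b := (best_factor p (\sum_(j in J) n j)%N).
Hypothesis bound : forall s, (forall j, 0 < s j) ->
  `|D s - D' s| <= C * scaled_total J sigma s.
Hypothesis between : forall s, (forall j, 0 < s j) ->
  0 <= (D s - D' s) * (D' s - b * sigma i * scaled_total J sigma s).

Let A (y : E) := D (sums y) / sigma i.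
Let A' (y : E) := D' (sums y) / sigma i.
Let V (y : E) := b * scaled_total J sigma (sums y).

Let mA : measurable_fun [set: E] A. Proof. exact: measurable_funM. Qed.
Let mA' : measurable_fun [set: E] A'. Proof. exact: measurable_funM. Qed.
Let mV : measurable_fun [set: E] V.
Proof.
apply: measurable_funM => //; rewrite /scaled_total.
under eq_fun do rewrite -big_enum/=.
apply: measurable_sum => j; apply: measurable_funM => //.
exact: measurable_sums.
Qed.

Let between_scaled y : (forall ij, 0 < y ij) ->
  0 <= (A y - A' y) * (A' y - V y).
Proof.
move=> /sums_gt0 /between; have si := sigma0 i.
rewrite /A /A' /V => h; rewrite (_ : _ * _ = (D (sums y) - D' (sums y)) *
  (D' (sums y) - b * sigma i * scaled_total J sigma (sums y)) / sigma i ^+ 2).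
  by rewrite divr_ge0// sqr_ge0.
by field; rewrite gt_eqF.
Qed.

Let stationary (M : E -> R) :
  (forall y, 0 <= M y) -> measurable_fun [set: E] M ->
  (forall l y, 0 < l -> M (shrink (block J) l y) = M y / l) ->
  (\int[P sigma]_w (M (obs w) * expR (p * (V (obs w) - 1)))%:E =
   \int[P sigma]_w (M (obs w))%:E)%E.
Proof.
move=> M0 mM Ml.
have := integral_stationary indep r0 law (enum_uniq _ : uniq (block J)) p0
  M0 mM Ml.
by under eq_integral do rewrite block_total size_block.
Qed.

Let part_fin (M : E -> R) : measurable_fun [set: E] M ->
  (forall y, 0 <= M y <= `|p * (A y - A' y)|) ->
  (\int[P sigma]_w (M (obs w))%:E < +oo)%E.
Proof.
move=> mM MAA'.
have mt : measurable_fun [set: T]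
    (fun w => `|weighted_sum r (block J) (obs w)|).
  apply: measurableT_comp => //.
  exact: (measurableT_comp (measurable_total r (block J))
    (measurable_joint observation)).
apply: (@le_lt_trans _ _ (\int[P sigma]_w (`|p * (C / sigma i)| *
    `|weighted_sum r (block J) (obs w)|)%:E)%E).
  apply: ae_ge0_le_integral => //.
  - by move=> w _; rewrite lee_fin; case/andP: (MAA' (obs w)).
  - apply/measurable_EFinP.
    exact: (measurableT_comp mM (measurable_joint observation)).
  - by apply/measurable_EFinP; exact: measurable_funM.
  apply: filterS observations_gt0 => w /sums_gt0 Sw _; rewrite lee_fin.
  case/andP: (MAA' (obs w)) => _ /le_trans; apply.
  rewrite block_total /A /A' -mulrBl -normrM mulrA !normrM -!mulrA.
  rewrite ler_wpM2l// [`|C| * _]mulrCA [leLHS]mulrC ler_wpM2l// -normrM.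
  exact: le_trans (bound Sw) (ler_norm _).
rewrite (integralZl_nneg _ (normr_ge0 _) mt)//.
rewrite lte_mul_pinfty ?lee_fin//.
exact: (integral_total_fin indep r0 law (enum_uniq _ : uniq (block J))).
Qed.

Let G (y : E) := excess p (A y) (A' y).
Let L (y : E) := deficit p (A y) (A' y).

Let mpAA' : measurable_fun [set: E] (fun y => p * (A y - A' y)).
Proof. by apply: measurable_funM => //; exact: measurable_funB. Qed.

Let mG : measurable_fun [set: E] G. Proof. exact: measurable_maxr. Qed.

Let mL : measurable_fun [set: E] L.
Proof. by apply: measurable_maxr => //; exact: measurableT_comp. Qed.

Let G_bounds y : 0 <= G y <= `|p * (A y - A' y)|.
Proof. by rewrite le_max lexx /= ge_max normr_ge0 ler_norm. Qed.

Let L_bounds y : 0 <= L y <= `|p * (A y - A' y)|.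
Proof. by rewrite le_max lexx /= ge_max normr_ge0 -normrN ler_norm. Qed.

Let pAA'_homogeneous l y : 0 < l ->
  p * (A (shrink (block J) l y) - A' (shrink (block J) l y)) =
  p * (A y - A' y) / l.
Proof. by move=> l0; rewrite /A /A' sums_shrink hD// hD'//; ring. Qed.

Let max_homogeneous (t l : R) : 0 < l -> Num.max 0 (t / l) = Num.max 0 t / l.
Proof. by move=> l0; rewrite maxr_pMl ?mul0r// invr_ge0 ltW. Qed.

Let G_homogeneous l y : 0 < l -> G (shrink (block J) l y) = G y / l.
Proof. by move=> l0; rewrite /G /excess pAA'_homogeneous// max_homogeneous. Qed.

Let L_homogeneous l y : 0 < l -> L (shrink (block J) l y) = L y / l.
Proof.
by move=> l0; rewrite /L /deficit pAA'_homogeneous// -mulNr max_homogeneous.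
Qed.

Let mAo := measurableT_comp mA (measurable_joint observation).
Let mA'o := measurableT_comp mA' (measurable_joint observation).
Let mVo := measurableT_comp mV (measurable_joint observation).

Let between_ae : {ae P sigma, forall w,
  0 <= (A (obs w) - A' (obs w)) * (A' (obs w) - V (obs w))}.
Proof. by apply: filterS observations_gt0 => w; exact: between_scaled. Qed.

Let G_fin := part_fin mG G_bounds.
Let L_fin := part_fin mL L_bounds.
Let G_stationary :=
  stationary (fun y => proj1 (andP (G_bounds y))) mG G_homogeneous.
Let L_stationary :=
  stationary (fun y => proj1 (andP (L_bounds y))) mL L_homogeneous.

Lemma statistic_risk_le :
  (\int[P sigma]_w (linex p (D' (sums (obs w)) / sigma i))%:E <=
   \int[P sigma]_w (linex p (D (sums (obs w)) / sigma i))%:E)%E.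
Proof.
exact: (linex_risk_le mAo mA'o mVo between_ae G_fin L_fin
  G_stationary L_stationary).
Qed.

Lemma statistic_risk_lt (Ev : set T) :
  (\int[P sigma]_w (linex p (D' (sums (obs w)) / sigma i))%:E < +oo)%E ->
  measurable Ev -> (0 < P sigma Ev)%E ->
  (forall w, Ev w -> (forall ij, 0 < obs w ij) /\
    D (sums (obs w)) != D' (sums (obs w))) ->
  (\int[P sigma]_w (linex p (D' (sums (obs w)) / sigma i))%:E <
   \int[P sigma]_w (linex p (D (sums (obs w)) / sigma i))%:E)%E.
Proof.
move=> fin mEv PEv EvD.
apply: (linex_risk_lt mAo mA'o mVo between_ae G_fin L_fin
  G_stationary L_stationary p0 fin mEv PEv) => w /EvD[w0 DD'].
split; last exact: between_scaled.
apply: contra DD' => /eqP; rewrite /A /A' /= => /mulIf ->//.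
by rewrite invr_eq0 gt_eqF// sigma0.
Qed.

End comparison.
End fixed_scales.
End model.

(** * The constants and the domination criterion *)

Section best_factor.
Context {R : realType} (p : R) (p0 : p != 0).

(** [(1 - e^(- p t)) / p] is increasing in [t], whatever the sign of [p]. *)
Lemma decay_lt (t u : R) : t < u ->
  p^-1 * (1 - expR (- p * t)) < p^-1 * (1 - expR (- p * u)).
Proof.
move=> tu; move: p0; rewrite neq_lt => /orP[pn|pp].
  rewrite ltr_nM2l ?invr_lt0// ltrD2l ltrN2 ltr_expR.
  by rewrite ltr_pM2l// oppr_gt0.
rewrite ltr_pM2l ?invr_gt0// ltrD2l ltrN2 ltr_expR.
by rewrite ltr_nM2l// oppr_lt0.
Qed.

Lemma best_factor_gt0 N : 0 < best_factor p N.
Proof.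
have := @decay_lt 0 (N + 1)%:R^-1; rewrite mulr0 expR0 subrr mulr0; apply.
by rewrite invr_gt0 ltr0n addn1.
Qed.

Lemma best_factor_lt N M : (N < M)%N -> best_factor p M < best_factor p N.
Proof.
move=> NM; apply: decay_lt.
by rewrite ltf_pV2 ?posrE ?ltr0n ?addn1// ltr_nat.
Qed.

End best_factor.

Lemma eq_divr_scale {R : fieldType} (x y l : R) : l != 0 ->
  (x / l) / (y / l) = x / y.
Proof. by move=> l0; rewrite invf_div mulrA divfK. Qed.

Section domination.
Context (R : realType) (disp : measure_display) (T : measurableType disp).
Context (k : nat) (n : 'I_k -> nat).
Variables (P : ('I_k -> R) -> probability T R).
Variable X : forall i : 'I_k, 'I_(n i) -> {mfun T >-> R}.
Hypothesis hX : exponential_samples P X.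
Hypothesis hn : forall i, (0 < n i)%N.
Variables (p : R) (p0 : p != 0).
Implicit Types (sigma s : 'I_k -> R) (J : {set 'I_k}).

Local Notation index := (observation_index n).
Local Notation E := (@coordinate_space R index).
Local Notation obs := (joint (observation X)).

Lemma riskE (i : 'I_k) (D : ('I_k -> R) -> R) sigma :
  risk P p i (fun w => D (sums (obs w))) sigma =
  (\int[P sigma]_w (linex p (D (sums (obs w)) / sigma i))%:E)%E.
Proof. by rewrite /risk unlock. Qed.

(** A set of positive probability on which the sums in [K] are small and the
    others are larger than 1; it makes the ratios of sums as extreme as needed
    for the improved estimators to differ from the original ones. *)
Definition contrast_box (K : {set 'I_k}) (e : R) : set E :=
  rectangle (fun ij : index =>
    if tag ij \in K then `]0, e]%classic else `]1, +oo[%classic).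

Lemma measurable_contrast K e : measurable (obs @^-1` contrast_box K e).
Proof.
rewrite -[X in measurable X]setTI; apply: measurable_joint => //.
by apply: measurable_rectangle => ij; case: ifP.
Qed.

Lemma contrast_gt0 K e sigma : positive_scales sigma -> 0 < e ->
  (0 < P sigma (obs @^-1` contrast_box K e))%E.
Proof.
move=> sigma0 e0; have [indep law] := hX sigma0.
rewrite (independent_rectangle indep); last by move=> ij; case: ifP.
apply: (big_ind (fun x => 0 < x)%E) => //; first by move=> x y; exact: mule_gt0.
have r0 ij : 0 < (sigma (tag ij))^-1 by rewrite invr_gt0; exact: sigma0.
move=> ij _.
case: ifP => _.
  by rewrite [ltRHS]law//; exact: exponential_prob_gt0.
by rewrite [ltRHS]law// exponential_prob_gt// lte_fin expR_gt0.
Qed.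

Lemma contrast_coordinate_gt0 K e y : contrast_box K e y -> forall ij, 0 < y ij.
Proof.
move=> Ky ij; have := Ky ij; case: ifP => _ /=; rewrite in_itv/= ?andbT.
  by case/andP.
exact: lt_trans.
Qed.

Lemma contrast_sum_le K e y i : contrast_box K e y -> i \in K ->
  sums y i <= (n i)%:R * e.
Proof.
move=> Ky iK; rewrite -[in leRHS](card_ord (n i)) mulr_natl -sumr_const.
apply: ler_sum => j _; have := Ky (Tagged (fun i => 'I_(n i)) j).
by rewrite /= iK /= in_itv/= => /andP[].
Qed.

Lemma contrast_sum_gt1 K e y i : contrast_box K e y -> i \notin K ->
  1 < sums y i.
Proof.
move=> Ky iK; rewrite /sums (bigD1 (Ordinal (hn i)))//=.
apply: ltr_wpDr.
  by apply: sumr_ge0 => j _; apply: ltW; exact: (contrast_coordinate_gt0 Ky).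
have := Ky (Tagged (fun i => 'I_(n i)) (Ordinal (hn i))).
by rewrite /= (negbTE iK) /= in_itv/= andbT.
Qed.

Lemma scaled_total1 (i : 'I_k) sigma s :
  scaled_total [set i] sigma s = s i / sigma i.
Proof. by rewrite /scaled_total big_set1. Qed.

Lemma linear_statistic_measurable (c : R) (i : 'I_k) :
  measurable_fun [set: E] (fun y : E => c * sums y i).
Proof. by apply: measurable_funM => //; exact: measurable_sums. Qed.

Lemma linear_risk_fin i sigma : positive_scales sigma ->
  (\int[P sigma]_w (linex p (best_factor p (n i) * sums (obs w) i / sigma i))%:E
   < +oo)%E.
Proof.
move=> sigma0; have := linex_scaled_total_fin hX p0 sigma0 [set i].
rewrite big_set1; congr (_ < _)%E; apply: eq_integral => w _.
by rewrite scaled_total1 mulrA.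
Qed.

(** For [J = {i}] the multiple [best_factor p (n i)] is the stationary point
    itself, so it lies between any other multiple and that point. *)
Lemma best_factor_optimal i :
  best_scale_equivariant P X p i (best_factor p (n i)).
Proof.
move=> sigma sigma0 c c_neq.
rewrite [ltLHS](riskE i (fun s => best_factor p (n i) * s i)).
rewrite [ltRHS](riskE i (fun s => c * s i)).
have si := sigma0 i; set b := best_factor p (n i).
have homogeneous (a l : R) s : 0 < l ->
    a * shrink_sums [set i] l s i = a * s i / l.
  by move=> l0; rewrite /shrink_sums inE eqxx mulrA.
have bound s : (forall j, 0 < s j) ->
    `|c * s i - b * s i| <= `|c - b| * sigma i * scaled_total [set i] sigma s.
  move=> s0; rewrite -mulrBl normrM scaled_total1 -mulrA ler_wpM2l//.
  by rewrite [sigma i * _]mulrC divfK ?gt_eqF// gtr0_norm.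
have between s : (forall j, 0 < s j) -> 0 <= (c * s i - b * s i) *
    (b * s i - best_factor p (\sum_(j in [set i]%SET) n j)%N * sigma i *
      scaled_total [set i] sigma s).
  move=> s0; rewrite scaled_total1 big_set1 -/b -mulrA [sigma i * _]mulrC.
  by rewrite divfK ?gt_eqF// subrr mulr0.
apply: (statistic_risk_lt hX hn p0 sigma0 (D := fun s => c * s i)
  (D' := fun s => b * s i)
  (linear_statistic_measurable c i) (linear_statistic_measurable b i)
  (homogeneous c) (homogeneous b) bound between (linear_risk_fin i sigma0)
  (measurable_contrast [set: 'I_k]%SET 1)
  (contrast_gt0 [set: 'I_k]%SET sigma0 ltr01)) => w Kw.
have w0 := contrast_coordinate_gt0 Kw; split => //.
by apply: contra c_neq => /eqP/mulIf->//; rewrite gt_eqF// (sums_gt0 hn w0).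
Qed.

(** The sums being almost surely positive, domination reduces to inequalities
    between vectors of positive sums; strictness is obtained at the parameter
    with all scales equal to 1. *)
Lemma domination_criterion J i (D' : ('I_k -> R) -> R) (C : ('I_k -> R) -> R)
    (Ev : set T) :
  i \in J ->
  measurable_fun [set: E] (fun y : E => D' (sums y)) ->
  (forall (l : R) s, 0 < l -> D' (shrink_sums J l s) = D' s / l) ->
  (forall sigma s, ordered_scales sigma -> (forall j, 0 < s j) ->
    `|best_factor p (n i) * s i - D' s| <= C sigma * scaled_total J sigma s) ->
  (forall sigma s, ordered_scales sigma -> (forall j, 0 < s j) ->
    0 <= (best_factor p (n i) * s i - D' s) *
      (D' s - best_factor p (\sum_(j in J) n j)%N * sigma i *
        scaled_total J sigma s)) ->
  measurable Ev -> (0 < P (fun=> 1%R) Ev)%E ->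
  (forall w, Ev w -> (forall ij, 0 < obs w ij) /\
    best_factor p (n i) * sums (obs w) i != D' (sums (obs w))) ->
  dominates P X p i (fun w => D' (sums (obs w)))
    (fun w => best_factor p (n i) * sums (obs w) i).
Proof.
move=> iJ mD' hD' bound between mEv PEv EvD.
have mD := linear_statistic_measurable (best_factor p (n i)) i.
have hD (l : R) s : 0 < l ->
    best_factor p (n i) * shrink_sums J l s i = best_factor p (n i) * s i / l.
  by move=> l0; rewrite /shrink_sums iJ mulrA.
have le_risk sigma : ordered_scales sigma ->
    (risk P p i (fun w => D' (sums (obs w))) sigma <=
     risk P p i (fun w => best_factor p (n i) * sums (obs w) i)%R sigma)%E.
  move=> sigma_ord; have [sigma0 _] := sigma_ord.
  rewrite [leRHS](riskE i (fun s => best_factor p (n i) * s i)) riskE.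
  exact: (statistic_risk_le hX hn p0 sigma0
    (D := fun s => best_factor p (n i) * s i) mD mD' hD hD'
    (fun s => @bound _ s sigma_ord) (fun s => @between _ s sigma_ord)).
split => //; first exact: is_estimator_statistic.
have one_ord : ordered_scales (fun _ : 'I_k => 1 : R) by split=> [j|i' j _].
exists (fun=> 1) => //; have [sigma0 _] := one_ord.
have := le_risk _ one_ord.
rewrite [leRHS](riskE i (fun s => best_factor p (n i) * s i)) !riskE => le1.
have fin := le_lt_trans le1 (linear_risk_fin i sigma0).
rewrite [ltRHS](riskE i (fun s => best_factor p (n i) * s i)).
exact: (statistic_risk_lt hX hn p0 sigma0
  (D := fun s => best_factor p (n i) * s i) mD mD' hD hD'
  (fun s => @bound _ s one_ord) (fun s => @between _ s one_ord)
  fin mEv PEv EvD).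
Qed.

End domination.

(** * The improved estimators *)

Section pooled_estimators.
Context (R : realType) (disp : measure_display) (T : measurableType disp).
Context (k : nat) (n : 'I_k -> nat).
Variables (P : ('I_k -> R) -> probability T R).
Variable X : forall i : 'I_k, 'I_(n i) -> {mfun T >-> R}.
Hypothesis hX : exponential_samples P X.
Hypothesis hn : forall i, (0 < n i)%N.
Variables (p : R) (p0 : p != 0).

Local Notation E := (@coordinate_space R (observation_index n)).
Local Notation obs := (joint (observation X)).
Local Notation c0 i := (best_factor p (n i)).

Let measurable_ratio (i j : 'I_k) :
  measurable_fun [set: E] (fun y : E => sums y j / sums y i).
Proof.
apply: measurable_funM; first exact: measurable_sums.
exact: (measurableT_comp (@measurable_invr R) (@measurable_sums R k n i)).
Qed.

Section smaller_scale.
Variables (i1 i2 : 'I_k) (lt12 : (i1 < i2)%N).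
Local Notation d := (best_factor p (n i1 + n i2)).

Definition truncate_above (s : 'I_k -> R) : R :=
  let U2 := s i2 / s i1 in
  if c0 i1 < d then d * s i1
  else if c0 i1 <= d * (1 + U2) then c0 i1 * s i1
  else d * (1 + U2) * s i1.

Let J : {set 'I_k} := [set i1; i2]%SET.

Let neq12 : i1 != i2. Proof. by rewrite -val_eqE /= ltn_eqF. Qed.

Let J_sum (V : nmodType) (F : 'I_k -> V) : \sum_(j in J) F j = F i1 + F i2.
Proof. by rewrite /J big_setU1 ?inE// big_set1. Qed.

Let d_pooled : best_factor p (\sum_(j in J) n j)%N = d.
Proof. by rewrite /J big_setU1 ?inE// big_set1. Qed.

Let d_lt : d < c0 i1.
Proof. by apply: best_factor_lt => //; rewrite -[ltnLHS]addn0 ltn_add2l. Qed.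

Let c0_gt0 : 0 < c0 i1 := best_factor_gt0 p0 _.
Let d_gt0 : 0 < d := best_factor_gt0 p0 _.

(** Since [d < c0 i1], the statistic is the smaller of [c0 S_1] and
    [d (S_1 + S_2)]. *)
Let truncate_aboveE (s : 'I_k -> R) : (forall j, 0 < s j) ->
  truncate_above s = if c0 i1 * s i1 <= d * (s i1 + s i2)
    then c0 i1 * s i1 else d * (s i1 + s i2).
Proof.
move=> s0; have s1 := s0 i1; rewrite /truncate_above ltNge ltW ?d_lt//=.
have pool : d * (1 + s i2 / s i1) * s i1 = d * (s i1 + s i2).
  by rewrite -mulrA mulrDl mul1r divfK// gt_eqF.
by rewrite -pool ler_pM2r.
Qed.

Let measurable_truncate_above :
  measurable_fun [set: E] (fun y : E => truncate_above (sums y)).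
Proof.
have mcut : measurable_fun [set: E]
    (fun y : E => d * (1 + sums y i2 / sums y i1)).
  by apply: measurable_funM => //; exact: measurable_funD.
rewrite /truncate_above; case: (c0 i1 < d).
  exact: linear_statistic_measurable.
apply: measurable_fun_ifT; first exact: measurable_fun_ler.
  exact: linear_statistic_measurable.
by apply: measurable_funM => //; exact: measurable_sums.
Qed.

Let truncate_above_homogeneous (l : R) s : 0 < l ->
  truncate_above (shrink_sums J l s) = truncate_above s / l.
Proof.
move=> l0; rewrite /truncate_above /shrink_sums !inE !eqxx orbT /=.
rewrite eq_divr_scale ?gt_eqF// !mulrA; case: (c0 i1 < d) => //.
by case: (c0 i1 <= _).
Qed.

Lemma truncate_above_dominates :
  dominates P X p i1 (fun w => truncate_above (sums (obs w)))
    (fun w => c0 i1 * sums (obs w) i1).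
Proof.
(* On the event, [S_1 > 1] and [d S_2 <= c0 - d], so that
   [c0 S_1 > d (S_1 + S_2)]. *)
pose e := (c0 i1 - d) / (d * (n i2)%:R).
have n2 : 0 < (n i2)%:R :> R by rewrite ltr0n.
have e0 : 0 < e.
  by apply: divr_gt0; [rewrite subr_gt0; exact: d_lt|exact: mulr_gt0].
have total (sigma s : 'I_k -> R) : scaled_total J sigma s =
    s i1 / sigma i1 + s i2 / sigma i2 by exact: J_sum.
apply: (domination_criterion hX hn p0 (J := J)
  (C := fun sigma => c0 i1 * sigma i1)
  (Ev := obs @^-1` contrast_box [set i2]%SET e)) => //.
- by rewrite !inE eqxx.
- move=> sigma s [sigma0 _] s0; have [s1 s2] := (s0 i1, s0 i2).
  have sig1 := sigma0 i1; have sig2 := sigma0 i2.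
  have t2 : 0 <= sigma i1 * (s i2 / sigma i2).
    by rewrite mulr_ge0 ?divr_ge0 ?ltW.
  have t : s i1 <= sigma i1 * scaled_total J sigma s.
    by rewrite total mulrDr mulrCA divff ?mulr1 ?lerDl// gt_eqF.
  rewrite truncate_aboveE// -mulrA; apply: (@le_trans _ _ (c0 i1 * s i1)).
    have x0 := mulr_gt0 c0_gt0 s1.
    have y0 := mulr_gt0 d_gt0 (addr_gt0 s1 s2).
    by case: (leP (c0 i1 * s i1)) => h;
      rewrite ler_norml; apply/andP; split; lra.
  by rewrite ler_pM2l.
- move=> sigma s [sigma0 mono] s0; have [s1 s2] := (s0 i1, s0 i2).
  have sig1 := sigma0 i1; have sig2 := sigma0 i2.
  have t : sigma i1 * scaled_total J sigma s <= s i1 + s i2.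
    rewrite total mulrDr mulrCA divff ?mulr1 ?lerD2l; last by rewrite gt_eqF.
    by rewrite mulrCA ger_pMr// ler_pdivrMr// mul1r mono// ltnW.
  rewrite d_pooled truncate_aboveE//; case: (leP (c0 i1 * s i1)) => [_|lt_d].
    by rewrite subrr mul0r.
  apply: mulr_ge0; rewrite subr_ge0; first exact: ltW.
  by rewrite -mulrA ler_pM2l.
- exact: measurable_contrast.
- by apply: contrast_gt0 => // j.
- move=> w Kw; have w0 := contrast_coordinate_gt0 Kw; split => //.
  have s0 := sums_gt0 hn w0.
  have s1 : 1 < sums (obs w) i1.
    by apply: (contrast_sum_gt1 hn Kw); rewrite inE.
  have s2 : sums (obs w) i2 <= (n i2)%:R * e.
    by apply: (contrast_sum_le Kw); rewrite inE.
  have {}s2 : d * sums (obs w) i2 <= c0 i1 - d.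
    have := s2; rewrite -(ler_pM2l d_gt0) => /le_trans; apply.
    by rewrite mulrA mulrC divfK// gt_eqF// mulr_gt0.
  rewrite truncate_aboveE//; case: (leP (c0 i1 * _)) => [|lt_d]; last first.
    by rewrite gt_eqF.
  have := d_lt; nra.
Qed.

End smaller_scale.

Section larger_scale.
Variables (i : 'I_k) (i_gt0 : (0 < i)%N).
Local Notation d := (best_factor p (\sum_(j < k) n j)%N).

Definition truncate_below (s : 'I_k -> R) : R :=
  let U := fun j : 'I_k => s j / s i in
  if c0 i < d * (1 + \sum_(j < k | (j < i)%N) U j)
  then d * (1 + \sum_(j < k | (j < i)%N) U j) * s i
  else c0 i * s i.

Let J : {set 'I_k} := [set: 'I_k]%SET.

Let d_pooled : best_factor p (\sum_(j in J) n j)%N = d.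
Proof. by congr (best_factor _ _); apply: eq_bigl => j; rewrite inE. Qed.

Let c0_gt0 : 0 < c0 i := best_factor_gt0 p0 _.
Let d_gt0 : 0 < d := best_factor_gt0 p0 _.

Let pooled (s : 'I_k -> R) := s i + \sum_(j < k | (j < i)%N) s j.

Let truncate_belowE (s : 'I_k -> R) : (forall j, 0 < s j) ->
  truncate_below s =
  if c0 i * s i < d * pooled s then d * pooled s else c0 i * s i.
Proof.
move=> s0; have si := s0 i; rewrite /truncate_below.
have -> : d * pooled s = d * (1 + \sum_(j < k | (j < i)%N) s j / s i) * s i.
  by rewrite -mulrA mulrDl mul1r -mulr_suml divfK// gt_eqF.
by rewrite ltr_pM2r.
Qed.

Let measurable_truncate_below :
  measurable_fun [set: E] (fun y : E => truncate_below (sums y)).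
Proof.
have mcut : measurable_fun [set: E] (fun y : E =>
    d * (1 + \sum_(j < k | (j < i)%N) sums y j / sums y i)).
  apply: measurable_funM => //; apply: measurable_funD => //.
  under eq_fun do rewrite -big_filter.
  exact: measurable_sum.
rewrite /truncate_below; apply: measurable_fun_ifT.
- exact: measurable_fun_ltr.
  by apply: measurable_funM => //; exact: measurable_sums.
exact: linear_statistic_measurable.
Qed.

Let truncate_below_homogeneous (l : R) s : 0 < l ->
  truncate_below (shrink_sums J l s) = truncate_below s / l.
Proof.
move=> l0; rewrite /truncate_below /shrink_sums.
have -> : \sum_(j < k | (j < i)%N) (if j \in J then s j / l else s j) /
    (if i \in J then s i / l else s i) = \sum_(j < k | (j < i)%N) s j / s i.
  by apply: eq_bigr => j _; rewrite !inE eq_divr_scale// gt_eqF.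
by rewrite inE !mulrA; case: (c0 i < _).
Qed.

(** Each [s j] with [j < i] is at most [s j * sigma i / sigma j], the scales
    being ordered, and the terms with [j > i] are nonnegative. *)
Let pooled_le sigma s : ordered_scales sigma -> (forall j, 0 < s j) ->
  pooled s <= sigma i * scaled_total J sigma s.
Proof.
move=> [sigma0 mono] s0; have si := sigma0 i.
have -> : scaled_total J sigma s = \sum_j s j / sigma j.
  by apply: eq_bigl => j; rewrite inE.
rewrite (bigD1 i)//= mulrDr mulrCA divff ?gt_eqF// mulr1 lerD2l mulr_sumr.
rewrite [leRHS](bigID (fun j : 'I_k => (j < i)%N))/=.
apply: (@le_trans _ _ (\sum_(j < k | (j < i)%N) sigma i * (s j / sigma j))).
  apply: ler_sum => j ji; rewrite mulrCA; apply: ler_peMr; first exact: ltW.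
  by rewrite ler_pdivlMr ?mul1r ?mono// ltnW.
rewrite [in leRHS](eq_bigl (fun j : 'I_k => (j < i)%N)).
  by rewrite lerDl sumr_ge0// => j _; rewrite mulr_ge0 ?divr_ge0 ?ltW.
by move=> j; case: ltnP => ji; rewrite ?andbF// andbT -val_eqE/= ltn_eqF.
Qed.

Lemma truncate_below_dominates :
  dominates P X p i (fun w => truncate_below (sums (obs w)))
    (fun w => c0 i * sums (obs w) i).
Proof.
(* On the event, [c0 S_i <= d], while the pooled sum is larger than 1. *)
pose e := d / (c0 i * (n i)%:R).
have ni : 0 < (n i)%:R :> R by rewrite ltr0n.
have e0 : 0 < e by apply: divr_gt0 => //; exact: mulr_gt0.
apply: (domination_criterion hX hn p0 (J := J) (C := fun sigma => d * sigma i)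
  (Ev := obs @^-1` contrast_box [set i]%SET e)) => //.
- by rewrite inE.
- move=> sigma s sigma_ord s0; have pool := pooled_le sigma_ord s0.
  have [sigma0 _] := sigma_ord.
  have V0 : 0 <= d * sigma i * scaled_total J sigma s.
    apply: mulr_ge0; first by apply: mulr_ge0; apply: ltW => //; exact: sigma0.
    by apply: sumr_ge0 => j _; apply: divr_ge0; apply: ltW => //; exact: sigma0.
  rewrite truncate_belowE//.
  case: (ltP (c0 i * s i)) => lt_d; last by rewrite subrr normr0.
  rewrite ler0_norm ?subr_le0 ?ltW// opprB.
  have := mulr_gt0 c0_gt0 (s0 i).
  have : d * pooled s <= d * sigma i * scaled_total J sigma s.
    by rewrite -mulrA ler_pM2l.
  lra.
- move=> sigma s sigma_ord s0; have pool := pooled_le sigma_ord s0.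
  rewrite d_pooled truncate_belowE//.
  case: (ltP (c0 i * s i)) => lt_d; last first.
    by rewrite subrr mul0r.
  apply: mulr_le0; rewrite subr_le0; first exact: ltW.
  by rewrite -mulrA ler_pM2l.
- exact: measurable_contrast.
- by apply: contrast_gt0 => // j.
- move=> w Kw; have w0 := contrast_coordinate_gt0 Kw; split => //.
  have s0 := sums_gt0 hn w0.
  pose j0 := Ordinal (ltn_trans i_gt0 (ltn_ord i)).
  have s_j0 : 1 < sums (obs w) j0.
    apply: (contrast_sum_gt1 hn Kw); rewrite inE -val_eqE /=.
    by rewrite neq_ltn i_gt0.
  have si : sums (obs w) i <= (n i)%:R * e.
    by apply: (contrast_sum_le Kw); rewrite inE.
  have {}si : c0 i * sums (obs w) i <= d.
    have := si; rewrite -(ler_pM2l c0_gt0) => /le_trans; apply.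
    by rewrite mulrA mulrC divfK// gt_eqF// mulr_gt0.
  have big_pool : 1 < pooled (sums (obs w)).
    rewrite /pooled (bigD1 j0)//= addrCA; apply: ltr_wpDr => //.
    by rewrite addr_ge0 ?sumr_ge0 ?ltW// => j _; exact: ltW.
  rewrite truncate_belowE//; case: (ltP (c0 i * _)) => [/lt_eqF->//|].
  have : d < d * pooled (sums (obs w)) by rewrite ltr_pMr.
  lra.
Qed.

End larger_scale.
End pooled_estimators.

Theorem corollary2p3 (R : realType) (disp : measure_display)
    (T : measurableType disp) (k : nat) (hk : (1 < k)%N)
    (n : 'I_k -> nat) (hn : forall i, (0 < n i)%N)
    (p : R) (hp : p != 0)
    (P : ('I_k -> R) -> probability T R)
    (X : forall i : 'I_k, 'I_(n i) -> {mfun T >-> R})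
    (hX : exponential_samples P X) :
  let S := sample_sum X in
  let i1 : 'I_k := Ordinal (ltnW hk) in
  let i2 : 'I_k := Ordinal hk in
  let d1 : R := p^-1 * (1 - expR (- p / (n i1 + n i2 + 1)%:R)) in
  let d2 : R := p^-1 * (1 - expR (- p / (\sum_(j < k) n j + 1)%:R)) in
  let c0 : 'I_k -> R := fun i => p^-1 * (1 - expR (- p / (n i + 1)%:R)) in
  [/\ best_scale_equivariant P X p i1 (c0 i1),
      inadmissible P X p i1 (fun w => c0 i1 * S i1 w) &
      dominates P X p i1
        (fun w => let U2 := S i2 w / S i1 w in
           if c0 i1 < d1 then d1 * S i1 w
           else if c0 i1 <= d1 * (1 + U2) then c0 i1 * S i1 w
           else d1 * (1 + U2) * S i1 w)
        (fun w => c0 i1 * S i1 w)] /\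
  (forall i : 'I_k, (0 < i)%N ->
   [/\ best_scale_equivariant P X p i (c0 i),
       inadmissible P X p i (fun w => c0 i * S i w) &
       dominates P X p i
         (fun w => let U := fun j : 'I_k => S j w / S i w in
            if c0 i < d2 * (1 + \sum_(j < k | (j < i)%N) U j)
            then d2 * (1 + \sum_(j < k | (j < i)%N) U j) * S i w
            else c0 i * S i w)
         (fun w => c0 i * S i w)]).
Proof.
move=> S i1 i2 d1 d2 c0.
have dom1 := truncate_above_dominates hX hn hp (isT : (i1 < i2)%N).
split.
  by split; [exact: best_factor_optimal|eexists; exact: dom1|exact: dom1].
move=> i i_gt0; have dom := truncate_below_dominates hX hn hp i_gt0.
by split; [exact: best_factor_optimal|eexists; exact: dom|exact: dom].
Qed.
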